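(* Let $n$ be a positive, odd, squarefree integer such that $n = u^2 + v^2$ for some integers $u, v$. Let $m$ be a positive integer all of whose prime factors are congruent to $1 \pmod 4$ (with $m = 1$ allowed). Then the ternary quadratic form $\langle 2,2,4n+1,2,2,0\rangle$ does not integrally represent $n m^2$; that is, there are no integers $x,y,z$ with $$2x^2 + 2y^2 + (4n+1)z^2 + 2yz + 2zx = n m^2.$$
   Context: The integer sextuple $\langle a,b,c,r,s,t\rangle$ denotes the ternary quadratic form $f(x,y,z) = a x^2 + b y^2 + c z^2 + r yz + s zx + t xy$. The notation $f \neq n m^2$ (going back to Jones and Pall) means that $f$ does not integrally represent any number $n m^2$ where all prime factors of $m$ are congruent to $1 \pmod 4$. *)

(* Defs.v *)
From mathcomp Require Import all_boot all_order all_algebra.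

Set Implicit Arguments.
Unset Strict Implicit.
Unset Printing Implicit Defensive.

Import GRing.Theory.
Local Open Scope ring_scope.

(* The sextuple <a, b, c, r, s, t>: r, s, t are the full coefficients of the
   mixed terms y z, z x, x y (in this order), not their halves. *)
Definition ternary_form (a b c r s t : int) (x y z : int) : int :=
  a * x ^+ 2 + b * y ^+ 2 + c * z ^+ 2 + r * (y * z) + s * (z * x) + t * (x * y).

Definition represents (f : int -> int -> int -> int) (k : int) : Prop :=
  exists x y z : int, f x y z = k.

Definition squarefree (n : nat) : Prop :=
  forall d : nat, (d ^ 2 %| n)%N -> d = 1%N.

Definition primes_1mod4 (m : nat) : Prop :=
  forall p : nat, prime p -> (p %| m)%N -> p = 1 %[mod 4].

(* Main.v *)
Require Import Defs.
From mathcomp Require Import all_boot all_order all_algebra.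
From mathcomp Require Import zify ring.

Import GRing.Theory Num.Theory.
Local Open Scope ring_scope.

(** Put [P = x + y + z], [Q = x - y] and [w = |z|].  Completing squares,
    [f (x, y, z) = P ^ 2 + Q ^ 2 + 4 n z ^ 2], so a representation of [n m ^ 2]
    gives
    [[
      P ^ 2 + Q ^ 2 = n (m - 2 w) (m + 2 w).
    ]]
    The factor [m - 2 w] is positive, because the left side is nonnegative and
    [m] is odd.  Both [n] and [m] are odd, so [P + Q] and hence [w] are odd;
    since [m = 1 mod 4], the factor [m - 2 w] is [3 mod 4].  A positive integer
    that is [3 mod 4] contains some prime [p = 3 mod 4] to an odd power
    ([modn4_1_of_even_logn]), whereas a sum of two squares contains every such
    prime to an even power ([even_logn_sum2sq]).  The latter applies to
    [P ^ 2 + Q ^ 2] and to [n], so [p] also divides the other factor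
    [m + 2 w].  Hence the odd prime [p] divides the sum [2 m] of the two
    factors, so it divides [m], whose prime factors are all [1 mod 4]. *)

(** This is the fact that [-1] is not a square modulo [p].  Write
    [p = 2 k + 1] with [k] odd.  Modulo [p], raising [a ^ 2 = - b ^ 2] to the
    power [k] and multiplying by [a b] gives [a ^ p b = - a b ^ p], that is
    [2 a b = 0] by Fermat's little theorem. *)
Lemma dvdn_sum2sq (p a b : nat) :
    prime p -> (p %% 4 = 3)%N -> (p %| a ^ 2 + b ^ 2)%N ->
  (p %| a)%N /\ (p %| b)%N.
Proof.
move=> p_pr p3; pose F := 'F_p.
have dvd0 c : (p %| c)%N = (c%:R == 0 :> F).
  by rewrite (dvdn_pcharf (pchar_Fp p_pr)).
rewrite !dvd0 natrD !natrX; set x : F := a%:R; set y : F := b%:R.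
move=> /eqP/addr0_eq sum0.
have fermat c : (c%:R : F) ^+ p = c%:R.
  by rewrite -(pFrobenius_autE (pchar_Fp p_pr)) rmorph_nat.
(* [k = (p - 1) / 2], in a form that shows that it is odd. *)
pose k := (p %/ 4).*2.+1.
have pE : p = (2 * k).+1 by rewrite /k; lia.
have pow_p z : z ^+ p = (z ^+ 2) ^+ k * z :> F by rewrite -exprM -exprSr -pE.
have xyN : x * y = - (x * y).
  rewrite -{1}[x](fermat a) pow_p -/x -[x ^+ 2]opprK sum0.
  rewrite exprNn -signr_odd /= odd_double expr1 mulN1r !mulNr.
  by rewrite mulrAC -pow_p fermat mulrC.
have two_neq0 : (2%:R : F) != 0.
  by rewrite -dvd0; apply/negP => /(dvdn_leq (isT : 0 < 2)%N); lia.
have /eqP : x * y = 0.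
  apply/eqP; rewrite -(mulrI_eq0 _ (mulfI two_neq0)).
  by rewrite mulr_natl mulr2n {1}xyN addNr.
rewrite mulf_eq0 => /orP[]/eqP z0; move: sum0; rewrite z0 expr0n /=.
  by rewrite oppr0 => /esym/eqP; rewrite sqrf_eq0 => /eqP->.
by move/eqP; rewrite oppr_eq0 sqrf_eq0 => /eqP->.
Qed.

(** A prime [p = 3 mod 4] that divides [a ^ 2 + b ^ 2] divides [a] and [b], so
    [p ^ 2] can be cancelled: the prime leaves in pairs. *)
Lemma even_logn_sum2sq (p a b : nat) :
  prime p -> (p %% 4 = 3)%N -> ~~ odd (logn p (a ^ 2 + b ^ 2)).
Proof.
move=> p_pr p3; have p_gt1 := prime_gt1 p_pr.
have [N] := ubnP (a ^ 2 + b ^ 2)%N; elim: N a b => // N IH a b lt_abN.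
have [->|s_gt0] := posnP (a ^ 2 + b ^ 2)%N; first by rewrite logn0.
have [p_dvd|pNdvd] := boolP (p %| a ^ 2 + b ^ 2)%N; last first.
  by rewrite lognE (negPf pNdvd) !andbF.
have [/dvdnP[a' aE] /dvdnP[b' bE]] := dvdn_sum2sq _ _ _ p_pr p3 p_dvd.
have sE : (a ^ 2 + b ^ 2 = p ^ 2 * (a' ^ 2 + b' ^ 2))%N.
  by rewrite aE bE !expnMn -mulnDl mulnC.
have s'_gt0 : (0 < a' ^ 2 + b' ^ 2)%N by move: s_gt0; rewrite sE muln_gt0 => /andP[].
rewrite sE lognM ?expn_gt0 ?(prime_gt0 p_pr) // lognX oddD oddM /=; apply: IH.
apply: leq_trans (lt_abN : (_ <= N)%N).
by rewrite sE ltn_Pmull // (ltn_exp2l 0).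
Qed.

(** In the prime factorization of [k], every prime power is [1 mod 4]: either
    the prime is, or it is [3 mod 4] and occurs as a power of its square. *)
Lemma modn4_1_of_even_logn (k : nat) :
    odd k ->
    (forall p, prime p -> (p %% 4 = 3)%N -> ~~ odd (logn p k)) ->
  (k %% 4 = 1)%N.
Proof.
move=> k_odd k_even; have k_gt0 := odd_gt0 k_odd.
rewrite (prod_prime_decomp k_gt0) prime_decompE big_map big_seq.
apply: (big_ind (fun c => c %% 4 = 1)%N) => // [c d c1 d1|p].
  by rewrite -modnMm c1 d1.
rewrite mem_primes => /and3P[p_pr _ p_dvd] /=.
have p_odd := dvdn_odd p_dvd k_odd.
have [p1|p3] : (p %% 4 = 1 \/ p %% 4 = 3)%N by lia.
  by rewrite -modnXm p1 exp1n.
rewrite -(even_halfK (k_even p p_pr p3)) -mul2n expnM.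
by rewrite -modnXm -(modnXm 2) p3 exp1n.
Qed.

Theorem lemma2p1 (n m : nat)
    (n_gt0 : (0 < n)%N) (n_odd : odd n) (n_sqfree : squarefree n)
    (n_sum2sq : exists u v : int, n%:Z = u ^+ 2 + v ^+ 2)
    (m_gt0 : (0 < m)%N) (m_primes : primes_1mod4 m) :
  ~ represents (ternary_form 2 2 (4 * n%:Z + 1) 2 2 0) (n%:Z * m%:Z ^+ 2).
Proof.
case=> x [y [z]]; rewrite /ternary_form => f_eq.
have sum_eq : (x + y + z) ^+ 2 + (x - y) ^+ 2 = n%:Z * (m%:Z ^+ 2 - 4 * z ^+ 2).
  by rewrite mulrBr -f_eq; ring.
have m_odd : odd m.
  apply: contraT => m_even.
  by have := m_primes 2 isT; rewrite dvdn2 m_even => /(_ isT).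
have m1 : (m %% 4 = 1)%N.
  apply: modn4_1_of_even_logn => // p p_pr p3; rewrite lognE.
  by case: ifP => // /and3P[_ _ /(m_primes p p_pr)]; rewrite p3.
pose w := `|z|%N.
have abs_sq (c : int) : c ^+ 2 = (`|c| ^ 2)%N%:Z.
  by rewrite -abszX gez0_abs ?sqr_ge0.
have w_lt : (2 * w < m)%N.
  rewrite ltnNge; apply/negP => m_le.
  have w_neq : (2 * w != m)%N by apply: contraTneq m_odd => <-; rewrite oddM.
  have m_sq_lt : (m ^ 2 < 4 * w ^ 2)%N.
    by rewrite -[4%N]/(2 ^ 2)%N -expnMn ltn_sqr ltn_neqAle eq_sym w_neq.
  have := addr_ge0 (sqr_ge0 (x + y + z)) (sqr_ge0 (x - y)).
  rewrite sum_eq (abs_sq z) -/w (abs_sq m) pmulr_rge0 //= subr_ge0; lia.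
pose P := absz (x + y + z); pose Q := absz (x - y).
have PQ : (P ^ 2 + Q ^ 2 = n * ((m - 2 * w) * (m + 2 * w)))%N.
  have w_sq_le : (2 ^ 2 * w ^ 2 <= m ^ 2)%N by rewrite -expnMn leq_sqr ltnW.
  apply/eqP; rewrite -eqz_nat -subn_sqr expnMn PoszD (PoszM n) -subzn //.
  by rewrite (PoszM (2 ^ 2)%N) -!abs_sq sum_eq (abs_sq z).
have w_odd : odd w.
  have <- : odd P (+) odd Q = odd w by rewrite /P /Q /w; clear; lia.
  have := congr1 odd PQ; rewrite !(oddD, oddM, oddX, oddB) ?(ltnW w_lt) //=.
  by rewrite n_odd m_odd.
have A3 : ((m - 2 * w) %% 4 = 3)%N by move: m1 w_odd w_lt; clear; lia.
have A_odd : odd (m - 2 * w) by move: A3; clear; lia.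
suff A1 : ((m - 2 * w) %% 4 = 1)%N by rewrite A1 in A3.
apply: modn4_1_of_even_logn => // p p_pr p3.
apply/negP => p_oddA.
have := even_logn_sum2sq p P Q p_pr p3.
case: n_sum2sq => u [v n_eq].
have nE : (n = `|u| ^ 2 + `|v| ^ 2)%N.
  by rewrite !abs_sq in n_eq; case: n_eq.
have := even_logn_sum2sq p `|u| `|v| p_pr p3; rewrite -nE => p_evenn.
have A_gt0 : (0 < m - 2 * w)%N by rewrite subn_gt0.
have B_gt0 : (0 < m + 2 * w)%N by rewrite addn_gt0 m_gt0.
rewrite PQ !lognM ?muln_gt0 ?A_gt0 // !oddD (negPf p_evenn) p_oddA /= negbK.
move=> p_oddB.
have pA : (p %| m - 2 * w)%N by move: p_oddA; rewrite lognE; case: and3P => // -[].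
have pB : (p %| m + 2 * w)%N by move: p_oddB; rewrite lognE; case: and3P => // -[].
have : (p %| 2 * m)%N.
  have -> : (2 * m = (m - 2 * w) + (m + 2 * w))%N.
    by move: w_lt; clear; lia.
  exact: dvdn_add.
rewrite Euclid_dvdM // => /orP[/(dvdn_leq (isT : 0 < 2)%N)|/(m_primes p p_pr)];
  move: p3; clear; lia.
Qed.
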